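(* Let $n\ge 5$. Then there exist $z_1\in D$ and $q\in S_{n-1}$ such that for any complex number $w_0$ with $|w_0|=1$ one has $$\min_{\zeta\in Z((p^* )')}|w_0-\zeta|<\min_{\omega\in Z(p')}|z_1-\omega|,$$ where $p(z)=(z-z_1)q(z)$ and $p^*(z)=(z-w_0)q(z)$.
   Context: $D$ is the open unit disk in $\mathbf{C}$. $S_m$ is the set of monic complex polynomials of degree $m$ having all their zeros in the closed unit disk. $Z(f)$ denotes the zero set of $f$, and $'$ denotes the derivative. *)

(* Defs.v *)
From mathcomp Require Import all_boot all_order all_algebra.
From mathcomp Require Import complex.
From mathcomp Require Import boolp classical_sets reals.

Set Implicit Arguments.
Unset Strict Implicit.
Unset Printing Implicit Defensive.

Import Order.TTheory GRing.Theory Num.Theory.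
Local Open Scope classical_set_scope.
Local Open Scope ring_scope.

(* On [R[i]], [`|z|] is the modulus embedded in [R[i]], and [x <= y] (resp.
   [x < y]) means that [y - x] is real and nonnegative (resp. positive);
   between moduli these are the usual real inequalities. *)

Definition open_unit_disk (R : realType) : set R[i] := [set z | `|z| < 1].

Definition closed_unit_disk (R : realType) : set R[i] := [set z | `|z| <= 1].

Definition zero_set (R : realType) (f : {poly R[i]}) : set R[i] :=
  [set z | root f z].

Definition monic_disk_poly (R : realType) (m : nat) : set {poly R[i]} :=
  [set q | q \is monic /\ size q = m.+1 /\
           zero_set q `<=` @closed_unit_disk R].

Definition is_min (R : realType) (A : set R[i]) (m : R[i]) : Prop :=
  A m /\ lbound A m.

(* Main.v *)
(* Take z1 = 0 and q = X^N - 1 with N = n - 1, so that the zeros of p' all have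
   modulus n^(-1/N). Let zeta range over the zeros of (p^* )' and put
   u = w0 / (w0 - zeta). If c = w0^N <> 1 and t = c / (c - 1), the logarithmic
   derivatives of (p^* )' at w0 give sum u = 2 N t and
   sum u^2 = 4 N^2 t^2 - 3 N (N - 1) t, where Re t = 1/2 because |c| = 1.
   Summing Re (u^2) >= 4 Re u - 2 - |u|^2 then forces |u|^2 >= n/2 for some
   zeta, i.e. |w0 - zeta|^2 <= 2/n, and 2/n < n^(-2/N) exactly when
   2^N n^2 < n^N, which holds for n >= 5. *)
Require Import Defs.
From mathcomp Require Import all_boot all_order all_algebra.
From mathcomp Require Import complex.
From mathcomp Require Import boolp classical_sets reals.
From mathcomp Require Import ring.

Import Order.TTheory GRing.Theory Num.Theory.
Local Open Scope classical_set_scope.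
Local Open Scope ring_scope.

(** This is Q'/Q = S1 and (Q'/Q)' = -S2 cleared of denominators, by induction on [s] with the
    product rule. It trades roots for derivatives at a single point. *)
Lemma logderiv_prod_XsubC (F : fieldType) (s : seq F) (x : F) :
  x \notin s ->
  let Q := \prod_(z <- s) ('X - z%:P) in
  let S1 := \sum_(z <- s) (x - z)^-1 in
  let S2 := \sum_(z <- s) (x - z)^-1 ^+ 2 in
  Q^`().[x] = Q.[x] * S1 /\ Q^`()^`().[x] = Q.[x] * (S1 ^+ 2 - S2).
Proof.
elim: s => [|z s IHs] /=; first by rewrite !big_nil derivC linear0 hornerC; split; ring.
rewrite inE negb_or => /andP[xz /IHs[]] {IHs}.
rewrite !big_cons; set Q := \prod_(_ <- s) _.
set S1 := \sum_(_ <- s) _; set S2 := \sum_(_ <- s) _ => e1 e2.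
rewrite derivM derivXsubC mul1r derivD derivM derivXsubC mul1r.
rewrite !hornerE e1 e2 /=.
have : x - z != 0 by rewrite subr_eq0.
by move=> h; split; field.
Qed.

(** Termwise, Re (u^2) - 4 Re u + 2 + |u|^2 = 2 (Re u - 1)^2 >= 0. Strictness comes from |u|^2 < b
    and survives summation because [s] is nonempty. *)
Lemma sumRe_sqr_lt (C : numClosedFieldType) (b : C) (s : seq C) :
  s != [::] -> {in s, forall u, `|u| ^+ 2 < b} ->
  4 * 'Re (\sum_(u <- s) u) - (2 + b) *+ size s < 'Re (\sum_(u <- s) u ^+ 2).
Proof.
have step u : `|u| ^+ 2 < b -> 4 * 'Re u - (2 + b) < 'Re (u ^+ 2).
  move=> ub; rewrite -subr_gt0.
  have -> : 'Re (u ^+ 2) - (4 * 'Re u - (2 + b)) =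
            2 * ('Re u - 1) ^+ 2 + (b - `|u| ^+ 2).
    rewrite normC2_Re_Im [in 'Re (u ^+ 2)]expr2 ReM; ring.
  by rewrite ltr_wpDl ?subr_gt0 // mulr_ge0 ?ler0n // -realEsqr rpredB ?Creal_Re ?rpred1.
case: s => // u s _; elim: s u => [|v s IHs] u ub.
  by rewrite !big_seq1 step ?ub ?mem_head.
have ReD (x y : C) : 'Re (x + y) = 'Re x + 'Re y by rewrite raddfD.
rewrite big_cons [in X in _ < X]big_cons !ReD mulrDr.
rewrite [size _]/= [in X in _ - X]mulrS opprD addrACA.
rewrite ltrD ?step ?ub ?mem_head // IHs // => w ws.
by rewrite ub // inE ws orbT.
Qed.

(** On the unit circle the conjugate of [c] is [c^-1], so c / (c - 1) has conjugate 1 / (1 - c), and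
    the two add up to 1. *)
Lemma Re_unit_div_sub1 (C : numClosedFieldType) (c : C) :
  `|c| = 1 -> c != 1 -> 'Re (c / (c - 1)) = 2^-1.
Proof.
move=> c1 cn1.
have c0 : c != 0 by rewrite -normr_eq0 c1 oner_eq0.
have cV : c^* = c^-1 by rewrite invC_norm c1 expr1n invr1 mul1r.
have d0 : c - 1 != 0 by rewrite subr_eq0.
have d0' : 1 - c != 0 by rewrite subr_eq0 eq_sym.
rewrite ReE rmorphM fmorphV rmorphB rmorph1 /= cV; field.
by rewrite mulN1r c0 d0 d0'.
Qed.

(** In characteristic 0, the leading coefficient times a positive degree is nonzero. *)
Lemma size_deriv_num (R : numDomainType) (p : {poly R}) :
  size p^`() = (size p).-1.
Proof.
have [->|p0] := eqVneq p 0; first by rewrite linear0 size_poly0.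
apply/eqP; rewrite eqn_leq -ltnS prednK ?size_poly_gt0 // lt_size_deriv //=.
case sp : (size p).-1 => [//|m]; rewrite ltnNge; apply/negP => /leq_sizeP/(_ m (leqnn m)).
rewrite coef_deriv -sp => /eqP; rewrite mulrn_eq0 sp /= -sp.
by rewrite -/(lead_coef p) lead_coef_eq0 (negPf p0).
Qed.

Lemma near_critical_point (C : numClosedFieldType) (N : nat) (w : C) :
  (0 < N)%N -> `|w| = 1 ->
  exists2 z, root (('X - w%:P) * ('X^N - 1))^`() z &
             `|w - z| ^+ 2 <= 2 / N.+1%:R.
Proof.
move=> N0 w1; set p := _ * _; set c := w ^+ N.
have pE : p^`() = ('X^N - 1) + ('X - w%:P) * ('X^(N.-1) *+ N).
  by rewrite /p derivM derivXsubC mul1r derivB derivXn derivC subr0.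
have p1w : p^`().[w] = c - 1 by rewrite pE !hornerE subrr mul0r addr0.
(* If w^N = 1, then [w] is a double root of [p], hence itself a critical point at distance 0. *)
have [cE1|cn1] := eqVneq c 1.
  exists w; first by rewrite /root p1w cE1 subrr.
  by rewrite subrr normr0 expr0n divr_ge0 ?ler0n.
have cB0 : c - 1 != 0 by rewrite subr_eq0.
(* The powers of [w] in front turn w^(N-1), and below w^(N-2), into [c]. *)
have p2w : w * p^`()^`().[w] = 2 * N%:R * c.
  rewrite pE derivD derivM derivXsubC mul1r derivB derivXn derivC.
  rewrite !(hornerE, hornerMn, hornerXn) subrr mul0r /c -(prednK N0) exprS /= -mulr_natr; ring.
have p3w : w ^+ 2 * p^`()^`()^`().[w] = 3 * N%:R * (N%:R - 1) * c.
  rewrite pE derivD derivM derivXsubC mul1r derivB derivXn derivC subr0.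
  rewrite !derivD derivM derivXsubC mul1r !derivMn derivXn.
  rewrite !(hornerE, hornerMn, hornerXn) subrr mul0r /c.
  (* For N = 1 the exponent N - 2 is truncated, but the factor N - 1 vanishes. *)
  case: (N) N0 => [//|[|m]] _ /=; first by rewrite subrr; ring.
  have -> : m.+2%:R - 1 = m.+1%:R :> C by rewrite -natr1 addrK.
  by rewrite -[_ *+ m.+1]mulr_natr -[_ *+ m.+2]mulr_natr !exprS; ring.
have p_size : size p = N.+2.
  rewrite size_monicM ?monicXsubC ?monic_neq0 ?monicXnsubC //.
  by rewrite size_XsubC size_XnsubC.
have [s] := closed_field_poly_normal p^`(); set a := lead_coef _ => ps.
have a0 : a != 0.
  by rewrite /a lead_coef_eq0 -size_poly_gt0 size_deriv_num p_size.
have rootE z : root p^`() z = (z \in s) by rewrite ps rootZ ?root_prod_XsubC.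
have sizes : size s = N.
  have := size_deriv_num _ p; rewrite p_size ps size_scale // size_prod_XsubC.
  by case.
have ws : w \notin s by rewrite -rootE /root p1w.
(* Since p' = a Q, the quotients p''/p' and p'''/p' at [w] are S1 and S1^2 - S2; the factor [a]
   cancels. *)
have [] := logderiv_prod_XsubC _ s w ws; set Q := \prod_(_ <- s) _.
set S1 := \sum_(_ <- s) _; set S2 := \sum_(_ <- s) _ => Q1 Q2.
have Qw : a * Q.[w] = c - 1 by rewrite -p1w ps hornerZ.
have S1E : w * S1 = 2 * N%:R * (c / (c - 1)).
  have : w * (c - 1) * S1 = 2 * N%:R * c.
    by rewrite -p2w ps derivZ hornerZ Q1 -Qw; ring.
  by move=> h; apply: (mulIf cB0); rewrite mulrA mulrVK ?unitfE // -h; ring.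
have S2E : w ^+ 2 * S2 = (w * S1) ^+ 2 - 3 * N%:R * (N%:R - 1) * (c / (c - 1)).
  have : (w * S1) ^+ 2 * (c - 1) - w ^+ 2 * (c - 1) * S2 = 3 * N%:R * (N%:R - 1) * c.
    by rewrite -p3w ps !derivZ hornerZ Q2 -Qw; ring.
  move=> h; apply: (mulIf cB0); rewrite mulrBl !mulrA mulrVK ?unitfE // -h; ring.
(* By contradiction: if every critical point is farther away, all u = w / (w - z) satisfy |u|^2 < (N
   + 1) / 2. *)
have [/hasP[z zs zle]|/hasPn far] := boolP (has (fun z => `|w - z| ^+ 2 <= 2 / N.+1%:R) s).
  by exists z; rewrite ?rootE.
pose us := [seq w / (w - z) | z <- s].
have us0 : us != [::] by rewrite -size_eq0 size_map sizes -lt0n.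
have /(sumRe_sqr_lt _ _ _ us0) : {in us, forall u, `|u| ^+ 2 < N.+1%:R / 2}.
  move=> _ /mapP[z zs ->]; rewrite normrM normfV w1 mul1r exprVn.
  have := far _ zs; rewrite -real_ltNge ?rpredX ?normr_real ?rpredM ?rpredV ?rpred_nat //.
  move=> h; rewrite -[_ / 2]invrK invf_div ltf_pV2 //.
    by rewrite posrE (le_lt_trans _ h) // divr_ge0 ?ler0n.
  by rewrite posrE divr_gt0 ?ltr0n.
have c1 : `|c| = 1 by rewrite normrX w1 expr1n.
have Rs := Re_unit_div_sub1 _ _ c1 cn1.
rewrite size_map sizes !big_map.
have -> : \sum_(z <- s) w / (w - z) = w * S1 by rewrite mulr_sumr.
have -> : \sum_(z <- s) (w / (w - z)) ^+ 2 = w ^+ 2 * S2.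
  by rewrite mulr_sumr; apply: eq_bigr => z _; rewrite exprMn.
rewrite S2E S1E; set t := c / (c - 1) in Rs *.
set I := 'Im t; set m := (N%:R : C).
have -> : 'Re (2 * m * t) = m.
  by rewrite ReMl ?Rs ?rpredM ?rpred_nat //; field.
have -> : 'Re ((2 * m * t) ^+ 2 - 3 * m * (m - 1) * t) =
          (2 * m) ^+ 2 * (2^-1 * 2^-1 - I * I) - 3 * m * (m - 1) * 2^-1.
  rewrite exprMn raddfB /= [in X in X - _]ReMl ?rpredX ?rpredM ?rpred_nat //.
  rewrite [t ^+ 2]expr2 ReM Rs [in X in _ - X = _]ReMl ?Rs //.
  by rewrite !rpredM ?rpredB ?rpred_nat ?rpred1.
(* The bound (N + 1) / 2 is the value for which both sides differ exactly by the square of the real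
   number 2 N Im t, which would then have to be negative. *)
have -> : 4 * m - (2 + N.+1%:R / 2) *+ N =
   (2 * m) ^+ 2 * (2^-1 * 2^-1 - I * I) - 3 * m * (m - 1) * 2^-1 + (2 * m * I) ^+ 2.
  by rewrite -natr1 -mulr_natr -/m; field.
by rewrite gtrDl => /lt_geF; rewrite -realEsqr !rpredM ?rpred_nat ?Creal_Im.
Qed.

Lemma seq_argmin_norm (C : numDomainType) (w : C) (s : seq C) : s != [::] ->
  exists2 z, z \in s & {in s, forall y, `|w - z| <= `|w - y|}.
Proof.
elim: s => // a [_ _|b s IHs _].
  by exists a; rewrite ?mem_head // => y; rewrite inE => /eqP->.
have [//|z zs zmin] := IHs.
(* The order on [C] is partial, but moduli are real and so comparable. *)
case: (real_leP (normr_real (w - a)) (normr_real (w - z))) => h.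
  exists a; rewrite ?mem_head // => y; rewrite inE => /orP[/eqP->//|/zmin].
  exact: le_trans.
exists z; first by rewrite inE zs orbT.
by move=> y; rewrite inE => /orP[/eqP->|/zmin//]; exact: ltW.
Qed.

Lemma ex_min_dist_zero_set (R : realType) (f : {poly R[i]}) (w : R[i]) :
  (1 < size f)%N -> exists m, is_min [set `|w - z| | z in zero_set f] m.
Proof.
move=> f1; have [s fs] := closed_field_poly_normal f.
have f0 : f != 0 by rewrite -size_poly_gt0 ltnW.
have rootE z : root f z = (z \in s).
  by rewrite fs rootZ ?root_prod_XsubC // lead_coef_eq0.
have s0 : s != [::].
  apply: contraTneq f1 => s0; rewrite fs s0 big_nil -leqNgt.
  by rewrite alg_polyC size_polyC_leq1.
have [z zs zmin] := seq_argmin_norm _ w s s0.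
exists `|w - z|; split; first by exists z; rewrite // /zero_set /= rootE.
by move=> _ [y fy <-]; apply: zmin; rewrite -rootE.
Qed.

(** Cancel n^2 and put k = n - 5: it remains that 2^(4+k) < n^(2+k), which follows from 2^4 < 5^2,
    2^k <= 5^k and 5 <= n. *)
Lemma expn_pow_gap (n : nat) : (5 <= n)%N -> (2 ^ n.-1 * n ^ 2 < n ^ n.-1)%N.
Proof.
move=> n5; have /subnKC <- : (4 <= n.-1)%N by rewrite -ltnS prednK // (leq_trans _ n5).
set k := (_ - 4)%N; rewrite -[X in (_ < _ ^ X)%N]/(2 + (2 + k))%N.
rewrite mulnC [X in (_ < X)%N]expnD ltn_pmul2l ?expn_gt0 ?(leq_trans _ n5) //.
apply: (@leq_trans (5 ^ (2 + k))); last by rewrite leq_exp2r.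
have h : (2 ^ k <= 5 ^ k)%N by case: (k) => // m; rewrite leq_exp2r.
rewrite !expnD; apply: (@leq_ltn_trans (2 ^ 4 * 5 ^ k)); first by rewrite leq_mul.
by rewrite ltn_pmul2r ?expn_gt0.
Qed.

Theorem proposition1p4 (R : realType) (n : nat) (hn : (5 <= n)%N) :
  exists (z1 : R[i]) (q : {poly R[i]}),
    open_unit_disk z1 /\ monic_disk_poly n.-1 q /\
    forall w0 : R[i], `|w0| = 1 ->
      let p := ('X - z1%:P) * q in
      let pstar := ('X - w0%:P) * q in
      exists m_star m : R[i],
        is_min [set `|w0 - zeta| | zeta in zero_set (pstar^`())] m_star /\
        is_min [set `|z1 - omega| | omega in zero_set (p^`())] m /\
        m_star < m.
Proof.
have gap := expn_pow_gap n hn.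
case: n hn gap => // N hn gap; rewrite -pred_Sn in gap *.
have N0 : (0 < N)%N by rewrite -ltnS (leq_trans _ hn).
exists 0, ('X^N - 1); split; first by rewrite /open_unit_disk /= normr0 ltr01.
have qm : 'X^N - 1 \is @monic R[i] by exact: monicXnsubC.
have qs : size ('X^N - 1 : {poly R[i]}) = N.+1 by exact: size_XnsubC.
split.
  split=> //; split=> // z; rewrite /zero_set /closed_unit_disk /= /root.
  rewrite !(hornerE, hornerXn) subr_eq0 => /eqP zN.
  by rewrite -(ler_pXn2r N0) ?nnegrE ?ler01 // -normrX zN normr1 expr1n.
move=> w0 w01 p pstar.
have size1 (z : R[i]) : (1 < size (('X - z%:P) * ('X^N - 1))^`())%N.
  rewrite size_deriv_num size_monicM ?monicXsubC ?monic_neq0 //.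
  by rewrite size_XsubC qs ltnS.
have [ms ms_min] := ex_min_dist_zero_set _ _ w0 (size1 w0).
have [m m_min] := ex_min_dist_zero_set _ _ 0 (size1 0).
exists ms, m; split=> //; split=> //.
have n0 : (N.+1%:R : R[i]) != 0 by rewrite pnatr_eq0.
(* Here p = X^(N+1) - X, so a zero z of p' satisfies (N + 1) z^N = 1. *)
have [m0 mN] : 0 <= m /\ m ^+ N = N.+1%:R^-1.
  case: m_min => -[z]; rewrite /zero_set /= /root => zroot <- _; split=> //.
  rewrite sub0r normrN -normrX -[RHS]ger0_norm ?invr_ge0 ?ler0n //.
  congr (`|_|); apply: (mulfI n0); rewrite mulfV //; apply/eqP.
  rewrite -subr_eq0; move: zroot.
  rewrite derivM derivXsubC mul1r derivB derivXn derivC subr0.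
  rewrite !(hornerE, hornerMn, hornerXn) -[N in X in _ -> X](prednK N0).
  rewrite -[N in z ^+ N](prednK N0) exprS.
  by congr (_ == 0); rewrite -natr1 -mulr_natr (prednK N0); ring.
have ms0 : 0 <= ms by case: ms_min => -[z _ <-].
have ms2 : ms ^+ 2 <= 2 / N.+1%:R.
  have [z zroot] := near_critical_point _ _ _ N0 w01.
  apply: le_trans; rewrite ler_pXn2r ?nnegrE //.
  by case: ms_min => _; apply; exists z.
(* Raising to the power 2 N avoids roots: only m^N and ms^2 are controlled, and [gap] gives (2 / (N
   + 1))^N < (N + 1)^(-2). *)
rewrite -(ltr_pXn2r (_ : (0 < 2 * N)%N)) ?nnegrE ?muln_gt0 //.
rewrite exprM [(2 * N)%N]mulnC exprM mN.
apply: (@le_lt_trans _ _ ((2 / N.+1%:R) ^+ N)).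
  by rewrite ler_pXn2r ?nnegrE ?exprn_ge0 // divr_ge0 ?ler0n.
rewrite expr_div_n exprVn -[ltRHS]mul1r ltr_pdivrMr ?exprn_gt0 ?ltr0n //.
rewrite mul1r mulrC ltr_pdivlMr ?exprn_gt0 ?ltr0n //.
by rewrite -!natrX -natrM ltr_nat.
Qed.
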